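(* There is an absolute constant $c>0$ such that for all sufficiently large $N$, the zeroing out subrank of the matrix multiplication tensor satisfies $Q_{zo}(\langle N,N,N\rangle)\le N^2/2^{c\log^* N}$.
   Context: $\langle N,N,N\rangle=\sum_{i,j,k\in[N]}x_{i,j}y_{j,k}z_{k,i}$ with index set $[N]^2$ on each axis. For a tensor $T$ over $A\times B\times C$ and subsets $A'\subset A,B'\subset B,C'\subset C$, the zeroing out $T|_{A',B',C'}$ keeps the coefficients of $T$ on $A'\times B'\times C'$ and sets all others to zero. A tensor is a permutation of an identity tensor of size $k$ if its support has $k$ elements and every index on each axis occurs in at most one support element. $Q_{zo}(T)$ is the maximum $k$ such that some zeroing out of $T$ is a permutation of an identity tensor of size $k$. $\log^*$ is the iterated logarithm. *)

(* Defs.v *)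
From HB Require Import structures.
From mathcomp Require Import all_boot all_order all_algebra.
From mathcomp Require Import reals exp.
From mathcomp Require Import lra.

Set Implicit Arguments.
Unset Strict Implicit.
Unset Printing Implicit Defensive.
Import Order.TTheory GRing.Theory Num.Theory.
Local Open Scope ring_scope.

Definition tensor (F : fieldType) (A B C : finType) := {ffun A * B * C -> F}.

Section Tensors.
Variables (F : fieldType) (A B C : finType).
Implicit Type T : tensor F A B C.

(* The monomial x_a y_b z_c. *)
Definition monomial (a : A) (b : B) (c : C) : tensor F A B C :=
  [ffun t => (t == (a, b, c))%:R].

Definition tsupp T : {set A * B * C} := [set t | T t != 0].

Definition zero_out T (A' : {set A}) (B' : {set B}) (C' : {set C}) :
    tensor F A B C :=
  [ffun t => if [&& t.1.1 \in A', t.1.2 \in B' & t.2 \in C'] then T t else 0].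

(* Only the support matters: the nonzero coefficients need not be 1. *)
Definition is_perm_identity T (k : nat) : bool :=
  [&& #|tsupp T| == k,
      [forall a, #|[set t in tsupp T | t.1.1 == a]| <= 1]%N,
      [forall b, #|[set t in tsupp T | t.1.2 == b]| <= 1]%N
    & [forall c, #|[set t in tsupp T | t.2 == c]| <= 1]%N].

(* The bound on k excludes nothing: k is the cardinality of a support. *)
Definition Qzo T : nat :=
  (\max_(k < #|{: A * B * C}|.+1 |
      [exists A' : {set A}, exists B' : {set B}, exists C' : {set C},
         is_perm_identity (zero_out T A' B' C') k]) k)%N.

End Tensors.

Definition matmul_tensor (F : fieldType) (N : nat) :
    tensor F ('I_N * 'I_N)%type ('I_N * 'I_N)%type ('I_N * 'I_N)%type :=
  \sum_(i < N) \sum_(j < N) \sum_(k < N) monomial F (i, j) (j, k) (k, i).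

Section IteratedLog.
Variable R : realType.
Implicit Type x : R.

Definition log2 x : R := ln x / ln 2.

Lemma log2_le_sub1 x : 2 <= x -> log2 x <= x - 1.
Proof.
move=> x2; have ln2 : 1 / 2 <= ln 2 :> R.
  have := @le_ln1Dx R (- (1 / 2)) ltac:(lra).
  rewrite (_ : 1 + - (1 / 2) = 2^-1 :> R); last by lra.
  by rewrite lnV ?posrE; lra.
have lnx : ln x <= ln 2 + (x / 2 - 1).
  have -> : ln x = ln 2 + ln (x / 2).
    by rewrite ln_div ?posrE; lra.
  rewrite lerD2l; have := @le_ln1Dx R (x / 2 - 1) ltac:(lra).
  by rewrite (_ : 1 + (x / 2 - 1) = x / 2 :> R) //; lra.
rewrite /log2 ler_pdivrMr; last by lra.
nra.
Qed.

Lemma iter_log2_le1 x : exists k, iter k log2 x <= 1.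
Proof.
have bnd n : forall y : R, y <= n.+1%:R -> exists k, iter k log2 y <= 1.
  elim: n => [|n IHn] y yn; first by exists 0%N.
  have [y1|y1] := leP y 1; first by exists 0%N.
  have [y2|y2] := leP 2 y.
    have [|k hk] := IHn (log2 y); last by exists k.+1; rewrite iterSr.
    by apply: (le_trans (log2_le_sub1 y2)); rewrite lerBlDr natr1.
  exists 1%N => /=; rewrite /log2 ler_pdivrMr ?mul1r ?ln_gt0 ?ltr1n //.
  by rewrite ler_ln ?posrE; lra.
by apply: (bnd (Num.truncn x)); rewrite ltW // truncnS_gt.
Qed.

(* The least number of applications of log2 that brings x to at most 1. *)
Definition logstar x : nat := ex_minn (iter_log2_le1 x).

End IteratedLog.

(* Main.v *)
Require Import Defs.
From HB Require Import structures.
From mathcomp Require Import all_boot all_order all_algebra.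
From mathcomp Require Import boolp reals exp.
From mathcomp Require Import zify ring lra.

Set Implicit Arguments.
Unset Strict Implicit.
Unset Printing Implicit Defensive.
Import Order.TTheory GRing.Theory Num.Theory.

(* A zeroing out of <N,N,N> to an identity tensor of size k is a tripartite graph
   on 3N vertices, with at least k edges, in which every edge lies in exactly one
   triangle, so the bound is the Ruzsa-Szemeredi problem with the quantitative
   form that Fox's proof of the triangle removal lemma gives. To a vertex
   partition attach the energy, the sum over all pairs of vertices of d ln d,
   with d the edge density between their cells. The energy is at most 0, and for
   the trivial partition it is E ln (E / n^2), where E counts ordered edges. As
   long as the cells are not too small, most triangles have their three sides
   between large dense cells A, B, C. As an edge lies in only one triangle, one
   of the three pairs of cells is then "shattered": a constant fraction of it is
   covered by boundedly many rectangles in which the density is a small constant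
   times that of the pair. Refining the partition by the sides of the rectangles
   of all shattered pairs increases the energy by a constant times E, because a
   constant fraction of the edges lies in shattered pairs. With E = n^2 / 2^k
   this can happen only O(k) times, and each refinement enlarges the partition
   at most by three exponentials. *)

(** * Energy of a partition *)

Section Energy.
Local Open Scope ring_scope.
Variables (R : realType) (I : finType) (E : {set I}).

Definition density (S : finType) (P : I -> S) (s : S) : R :=
  #|[set i in E | P i == s]|%:R / #|[set i | P i == s]|%:R.

(* Cells without edges contribute 0, since [ln 0 = 0]. *)
Definition energy (S : finType) (P : I -> S) : R :=
  \sum_i density P (P i) * ln (density P (P i)).

Lemma density_ge0 (S : finType) (P : I -> S) s : 0 <= density P s.
Proof. by rewrite divr_ge0. Qed.

Lemma density_le1 (S : finType) (P : I -> S) s : density P s <= 1.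
Proof.
rewrite /density; set a := #|_|; set b := #|[set i | _]|.
have ab : (a <= b)%N.
  by apply/subset_leq_card/subsetP => i; rewrite !inE => /andP[].
have [b0|b0] := posnP b; first by rewrite b0 invr0 mulr0.
by rewrite ler_pdivrMr ?ltr0n // mul1r ler_nat.
Qed.

Lemma densityM (S : finType) (P : I -> S) s :
  #|[set i | P i == s]|%:R * density P s = #|[set i in E | P i == s]|%:R.
Proof.
rewrite /density; set a := #|[set i in E | _]|; set b := #|[set i | _]|.
have ab : (a <= b)%N.
  by apply/subset_leq_card/subsetP => i; rewrite !inE => /andP[].
have [b0|b0] := posnP b; last by rewrite mulrC divfK // pnatr_eq0 -lt0n.
by move: ab; rewrite b0 leqn0 => /eqP ->; rewrite mul0r.
Qed.

(** The density is the average over each cell of the indicator of [E], so the two have the same sum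
    against a function that is constant on cells. *)
Lemma sum_density (S : finType) (P : I -> S) (h : S -> R) :
  \sum_i density P (P i) * h (P i) = \sum_(i in E) h (P i).
Proof.
rewrite (partition_big P predT) //= [RHS](partition_big P predT) //=.
apply: eq_bigr => s _.
under eq_bigr => i /eqP -> do [].
under [RHS]eq_bigr => i /andP[_ /eqP ->] do [].
rewrite !sumr_const -mulrnAl -[in LHS]mulr_natl -[X in X%:R * _]cardsE.
rewrite densityM -[RHS]mulr_natl; congr (_%:R * _).
by apply: eq_card => i; rewrite !inE.
Qed.

Lemma ln2_le1 : ln 2 <= 1 :> R.
Proof. by rewrite (_ : 2 = 1 + 1) ?le_ln1Dx //; lra. Qed.

(** Tangent lines of the convex function x ln x at y and at y / 4; in the second, ln 4 <= 2 bounds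
    the coefficient 1 - ln 4 from below by -1. The implication for y = 0 guards against the
    convention ln 0 = 0. *)
Lemma xlnx_ge (x y : R) : 0 <= x -> 0 <= y -> (y = 0 -> x = 0) ->
  x - y <= x * (ln x - ln y) /\ - x - y / 4 <= x * (ln x - ln y).
Proof.
move=> x0 y0 xy; have [->|xN0] := eqVneq x 0; first by rewrite mul0r; lra.
have x_gt0 : 0 < x by rewrite lt0r xN0.
have y_gt0 : 0 < y.
  by rewrite lt0r y0 andbT; apply/eqP => /xy /eqP; apply/negP.
have yx_gt0 : 0 < y / x by rewrite divr_gt0.
have yxM : x * (y / x) = y by rewrite mulrC divfK.
have lnyx : ln (y / x) = ln y - ln x by rewrite ln_div ?posrE.
split.
  have /(_ _) := @le_ln1Dx R (y / x - 1); rewrite addrCA subrr addr0 lnyx.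
  move=> /(_ ltac:(lra)) h; nra.
have /(_ _) := @le_ln1Dx R (y / x / 4 - 1); rewrite addrCA subrr addr0.
move=> /(_ ltac:(lra)); rewrite ln_div ?posrE // lnyx.
have -> : 4 = 2 ^+ 2 :> R by lra.
rewrite lnXn // mulr2n => h; have := ln2_le1; nra.
Qed.

Lemma energy_le0 (S : finType) (P : I -> S) : energy P <= 0.
Proof.
apply: sumr_le0 => i _; rewrite mulr_ge0_le0 ?density_ge0 //.
by rewrite ln_le0 // density_le1.
Qed.

(* Each cell contributes at least zero by ln x <= x - 1; on Q the tangent line of
   x ln x at the smaller density d_P / 4 gives the extra terms. *)
Lemma energy_refine (S S' : finType) (P : I -> S) (P' : I -> S') (f : S' -> S)
    (Q : pred S') : (forall i, P i = f (P' i)) ->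
  energy P + 3 / 4 * (\sum_(i | Q (P' i)) density P (P i))
    - 2 * #|[set i in E | Q (P' i)]|%:R <= energy P'.
Proof.
move=> Pf; set d := fun i => density P (P i); set d' := fun i => density P' (P' i).
have dd' i : d i = 0 -> d' i = 0.
  move=> d0; have := densityM P (P i); rewrite -/(d i) d0 mulr0.
  move=> /esym/eqP; rewrite pnatr_eq0 cards_eq0 => /eqP e0.
  rewrite /d' /density (_ : [set _ in E | _] = set0) ?cards0 ?mul0r //.
  apply/setP => j; rewrite !inE; apply/negP => /andP[Ej /eqP jP].
  have : j \in set0 by rewrite -e0 inE Ej !Pf jP /=.
  by rewrite inE.
(* The function [ln (d i)] is constant on the cells of both partitions, so both sides equal its sum
   over [E]. *)
have eE : energy P = \sum_i d' i * ln (d i).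
  rewrite /energy (sum_density P (fun s => ln (density P s))).
  rewrite -[RHS](_ : \sum_i density P' (P' i) * ln (density P (f (P' i))) = _).
    by rewrite (sum_density P' (fun s => ln (density P (f s))));
       apply: eq_bigr => i _; rewrite Pf.
  by apply: eq_bigr => i _; rewrite /d Pf.
have sd : \sum_i d i = \sum_i d' i.
  have h (T : finType) (G : I -> T) : \sum_i density G (G i) = #|E|%:R.
    have := sum_density G (fun=> 1); rewrite sumr_const => <-.
    by apply: eq_bigr => i _; rewrite mulr1.
  by rewrite /d /d' !h.
have sQ : \sum_(i | Q (P' i)) d' i = #|[set i in E | Q (P' i)]|%:R.
  have h := sum_density P' (fun s => (Q s)%:R : R).
  rewrite big_mkcond (eq_bigr (fun i => density P' (P' i) * (Q (P' i))%:R)).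
    rewrite h -sum1_card natr_sum big_mkcond [RHS]big_mkcond /=.
    by apply: eq_bigr => i _; rewrite inE; case: (_ \in _) => //=; case: (Q _).
  by move=> i _; rewrite mulr_natr mulrb.
rewrite -sQ eE /energy -/d'.
(* As [d] and [d'] have the same sum, subtracting [d' i - d i] changes nothing in total, but it
   makes every summand nonnegative. *)
suff : 0 <= \sum_i (d' i * ln (d' i) - d' i * ln (d i) - (d' i - d i)
               - (if Q (P' i) then 3 / 4 * d i - 2 * d' i else 0)).
  rewrite !sumrB -sd subrr subr0 -big_mkcond /= sumrB -!mulr_sumr.
  rewrite /d; lra.
apply: sumr_ge0 => i _.
have [h1 h2] := xlnx_ge (density_ge0 P' (P' i)) (density_ge0 P (P i)) (@dd' i).
by rewrite -mulrBr /d /d'; case: ifP => _; lra.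
Qed.

Lemma energy_const : E != set0 ->
  energy (fun=> tt) = #|E|%:R * ln (#|E|%:R / #|I|%:R).
Proof.
move=> E0; rewrite /energy sumr_const.
have -> : density (fun=> tt) tt = #|E|%:R / #|I|%:R.
  rewrite /density; congr (_%:R / _%:R); apply: eq_card => i; rewrite !inE.
    by rewrite andbT.
  by rewrite eqxx.
rewrite -mulrnAl -[X in X * _]mulr_natl; congr (_ * _).
have I0 : #|I| != 0%N.
  by case/set0Pn: E0 => i _; rewrite -lt0n; apply/card_gt0P; exists i.
by rewrite mulrC divfK ?pnatr_eq0.
Qed.
End Energy.

(** * Shattered pairs of cells *)

Section Covering.
Variables (I J : finType) (r : J -> I -> bool).

(** Union bound; the factor [k] allows the bound M / k on each set to be a fraction. *)
Lemma card_has_le (X : {set I}) (zs : seq J) (k M : nat) :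
  (forall w, w \in zs -> k * #|[set u in X | r w u]| <= M) ->
  k * #|[set u in X | has (r^~ u) zs]| <= size zs * M.
Proof.
elim: zs => [|w zs IH] hM.
  by rewrite (_ : [set u in X | _] = set0) ?cards0 ?muln0 //;
    apply/setP => u; rewrite !inE andbF.
have -> : [set u in X | has (r^~ u) (w :: zs)]
   = [set u in X | r w u] :|: [set u in X | has (r^~ u) zs].
  by apply/setP => u; rewrite !inE /=; case: (u \in X).
have h1 := hM w (mem_head _ _).
have h2 := IH (fun v hv => hM v (mem_behead (s := w :: zs) hv)).
rewrite mulSn; apply: leq_trans (leq_add h1 h2).
by rewrite -mulnDr leq_mul2l cardsU leq_subr orbT.
Qed.

Lemma exchange_card (X : {set I}) (Z : {set J}) :
  \sum_(z in Z) #|[set u in X | r z u]| = \sum_(u in X) #|[set z in Z | r z u]|.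
Proof.
under eq_bigr => z _ do rewrite -sum1dep_card big_mkcondr.
under [RHS]eq_bigr => z _ do rewrite -sum1dep_card big_mkcondr.
exact: exchange_big.
Qed.

(* Greedy choice: while less than half of U is covered, some z in Z covers a
   1/s-fraction of the uncovered part, that is, at least |U|/(2s) new points. *)
Lemma half_cover (U : {set I}) (Z : {set J}) (s : nat) :
  0 < #|Z| ->
  (forall u, u \in U -> #|Z| <= s * #|[set z in Z | r z u]|) ->
  exists zs : seq J, [/\ size zs <= s, {subset zs <= Z}
    & #|U| <= 2 * #|[set u in U | has (r^~ u) zs]|].
Proof.
move=> Z0 hU.
have [U0|U0] := posnP #|U|; first by exists [::]; rewrite U0; split.
suff /(_ s) [zs [h1 h2 h3]] : forall i, exists zs : seq J,
  [/\ size zs <= i, {subset zs <= Z}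
    & (i * #|U| <= 2 * s * #|[set u in U | has (r^~ u) zs]|)
      || (#|U| <= 2 * #|[set u in U | has (r^~ u) zs]|)].
  exists zs; split => //; case/orP: h3 => // h3.
  case/card_gt0P: U0 => u /hU; case: (posnP s) => [->|s0]; first by rewrite mul0n leqNgt Z0.
  by move=> _; rewrite -(leq_pmul2l s0); lia.
elim=> [|i [zs [h1 h2 h3]]]; first by exists [::]; split.
case/boolP: (#|U| <= _) h3 => h3 /=; first by exists zs; split => //; rewrite ?h3 ?orbT //; lia.
rewrite orbF => hi; set W := [set u in U | ~~ has (r^~ u) zs].
have hW : #|U| = #|[set u in U | has (r^~ u) zs]| + #|W|.
  rewrite -[in LHS](cardsID [set u | has (r^~ u) zs]).
  by congr (_ + _); apply: eq_card => u; rewrite !inE // andbC.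
(* Averaging over [Z]: each point of [W] is covered by at least #|Z| / s elements of [Z]. *)
have [z zZ hz] : exists2 z, z \in Z & #|W| <= s * #|[set u in W | r z u]|.
  apply/exists_inP; apply: contraT => /exists_inPn hn.
  have : \sum_(z in Z) s * #|[set u in W | r z u]| < \sum_(z in Z) #|W|.
    have lt z : z \in Z -> s * #|[set u in W | r z u]| < #|W|.
      by move/hn; rewrite ltnNge.
    case/card_gt0P: Z0 => z0 z0Z; rewrite (bigD1 z0) //= [X in _ < X](bigD1 z0) //=.
    by rewrite -addSn leq_add ?lt // leq_sum // => z /andP[/lt/ltnW].
  rewrite -big_distrr exchange_card sum_nat_const big_distrr /= ltnNge => /negP[].
  rewrite mulnC -sum_nat_const leq_sum // => u; rewrite inE => /andP[uU _].
  exact: hU.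
exists (z :: zs); split; first by rewrite /= ltnS.
  by move=> x; rewrite inE => /predU1P[->|/h2].
have -> : #|[set u in U | has (r^~ u) (z :: zs)]|
   = #|[set u in U | has (r^~ u) zs]| + #|[set u in W | r z u]|.
  rewrite -[in LHS](cardsID [set u | has (r^~ u) zs]).
  by congr (_ + _); apply: eq_card => u; rewrite !inE /=;
    case: (u \in U); case: (has _ _); case: (r z u).
by apply/orP; left; move: hi hW hz h3; nia.
Qed.
End Covering.

Lemma card_pairs (V W : finType) (P : V -> W -> bool) :
  #|[set z : V * W | P z.1 z.2]| = \sum_x #|[set y | P x y]|.
Proof.
rewrite -sum1dep_card -(pair_big_dep xpredT P (fun _ _ => 1)) /=.
by apply: eq_bigr => x _; rewrite sum1dep_card.
Qed.

Lemma card_pairs_swap (V W : finType) (P : V -> W -> bool) :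
  #|[set z : V * W | P z.1 z.2]| = \sum_y #|[set x | P x y]|.
Proof.
rewrite card_pairs.
under eq_bigr => z _ do rewrite -sum1dep_card big_mkcond.
under [RHS]eq_bigr => z _ do rewrite -sum1dep_card big_mkcond.
exact: exchange_big.
Qed.

Section Shattering.
Variables (V : finType) (e : rel V).
Hypothesis tri_uniq : forall x y z z',
  e x y -> e x z -> e y z -> e x z' -> e y z' -> z = z'.

Definition edges_of : {set V * V} := [set z | e z.1 z.2].

Definition boxes (L : seq ({set V} * {set V})) : {set V * V} :=
  [set z : V * V | has (fun r : {set V} * {set V} => (z.1 \in r.1) && (z.2 \in r.2)) L].

(** The constants make the density inside the boxes at most 16 / 64 = 1 / 4 of the density of the
    pair, the ratio at which [energy_refine] takes its tangent line. *)
Definition shatters (A B : {set V}) (L : seq ({set V} * {set V})) : bool :=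
  (#|A| * #|B| <= 16 * #|setX A B :&: boxes L|) &&
  (64 * #|edges_of :&: (setX A B :&: boxes L)| <= #|edges_of :&: setX A B|).

(** The edge from x to [w] lies in a single triangle, so the first endpoint x determines the
    second. *)
Lemma card_edges_between_nbrs w :
  #|[set z in edges_of | e z.1 w && e w z.2]| <= #|V|.
Proof.
rewrite -(@card_in_imset _ _ (fun z => z.1)) ?max_card //.
move=> [x y] [x' y']; rewrite !inE /= => /and3P[xy xw wy] /and3P[xy' _ wy'] xx'.
rewrite -{x'}xx' in xy' *; congr (_, _).
exact: (tri_uniq xw).
Qed.

(** The three densities are at least 64 / s. The proof splits on whether at least 1/8 of the pairs
    in A x B have #|C| / s^2 or more common neighbours in C. If so, the last hypothesis makes the at
    most s^2 #|V| edges in the chosen rectangles negligible. *)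
Lemma shattering_triple (A B C : {set V}) (s : nat) :
  0 < #|A| -> 0 < #|B| -> 0 < #|C| ->
  64 * (#|A| * #|B|) <= s * #|edges_of :&: setX A B| ->
  64 * (#|C| * #|B|) <= s * #|edges_of :&: setX C B| ->
  64 * (#|A| * #|C|) <= s * #|edges_of :&: setX A C| ->
  s ^ 3 * #|V| <= #|A| * #|B| ->
  [\/ exists2 L, size L <= s ^ 2 & shatters A B L,
      exists2 L, size L <= s ^ 2 & shatters C B L
    | exists2 L, size L <= s ^ 2 & shatters A C L].
Proof.
move=> A0 B0 C0 dAB dCB dAC big.
have s0 : 0 < s by case: s dAB {dCB dAC big} => //; lia.
set cod := fun z : V * V => [set w in C | e z.1 w && e w z.2].
set U1 := [set z in setX A B | #|C| <= s ^ 2 * #|cod z|].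
(* If many pairs of A x B have large codegree in C, then the rectangles
   N(w) x N(w), w in C, do the job: each has at most |V| edges. *)
have [hU1|hU1] := leqP (#|A| * #|B|) (8 * #|U1|).
  have [|zs [zs1 zs2 zs3]] :=
      @half_cover _ _ (fun w z => e z.1 w && e w z.2) U1 C (s ^ 2) C0.
    by move=> z; rewrite inE => /andP[].
  apply: Or31; exists [seq ([set x | e x w], [set y | e w y]) | w <- zs].
    by rewrite size_map.
  have bxE z : (z \in boxes [seq ([set x | e x w], [set y | e w y]) | w <- zs])
             = has (fun w => e z.1 w && e w z.2) zs.
    by rewrite inE has_map; apply: eq_has => w /=; rewrite !inE.
  apply/andP; split.
    suff : #|[set u in U1 | has (fun w => e u.1 w && e w u.2) zs]| <=
       #|setX A B :&: boxes [seq ([set x | e x w], [set y | e w y]) | w <- zs]|.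
      by move: zs3 hU1; lia.
    apply/subset_leq_card/subsetP => z; rewrite [z \in setI _ _]inE bxE !inE.
    by case/andP=> /andP[-> _] ->.
  have := @card_has_le _ _ (fun w z => e z.1 w && e w z.2) edges_of zs 1 #|V|.
  move=> /(_ (fun w _ => _)); rewrite mul1n => h.
  have {}h := h ltac:(by move=> w; rewrite mul1n card_edges_between_nbrs).
  have le : #|edges_of :&: (setX A B :&:
      boxes [seq ([set x | e x w], [set y | e w y]) | w <- zs])| <= s ^ 2 * #|V|.
    apply: leq_trans (leq_trans h _); last by rewrite leq_mul2r zs1 orbT.
    apply/subset_leq_card/subsetP => z; rewrite inE => /andP[hz].
    by rewrite inE => /andP[_]; rewrite bxE [in X in _ -> X]inE hz.
  rewrite -(leq_pmul2l s0); apply: leq_trans dAB.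
  have : s * (s ^ 2 * #|V|) <= #|A| * #|B| by rewrite mulnA -expnS.
  by move: le; nia.
(* Otherwise N(x) x B' x is sparse in C x B for most x in A. These rectangles
   cover enough of C x B unless most of C has few neighbours in A', in which
   case A' x C' is itself sparse. *)
set B' := fun x => [set y in B | s ^ 2 * #|cod (x, y)| < #|C|].
set A' := [set x in A | #|B| <= 2 * #|B' x|].
have A'A : A' \subset A by apply/subsetP => x; rewrite inE => /andP[].
(* Each x outside [A'] has more than #|B| / 2 of its pairs in [U1], which is less than 1/8 of A x B;
   so less than a quarter of A is lost. *)
have hA' : 3 * #|A| <= 4 * #|A'|.
  have h : #|B| * #|A :\: A'| <= 2 * #|U1|.
    pose U1x x := [set y | (x, y) \in U1].
    have -> : #|U1| = \sum_x #|U1x x|.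
      by rewrite -card_pairs; apply: eq_card => -[x y]; rewrite inE.
    rewrite mulnC -sum_nat_const big_distrr /= [X in _ <= X](bigID (mem (A :\: A'))) /=.
    apply: leq_trans (leq_addr _ _); apply: leq_sum => x.
    rewrite !inE negb_and -ltnNge; case/andP => hx xA; rewrite xA /= in hx.
    have : #|B| = #|U1x x| + #|B' x|.
      rewrite addnC -(cardsID (B' x)); congr (_ + _); apply: eq_card => y; rewrite !inE.
        by case: (y \in B).
      by rewrite /= xA (leqNgt #|C|); case: (y \in B); rewrite ?andbT ?andbF.
    by move: hx; lia.
  have hA : #|A| = #|A'| + #|A :\: A'|.
    by rewrite -[LHS](cardsID A'); congr (_ + _); rewrite (setIidPr A'A).
  by move: B0 h hU1; nia.
set C' := [set z in C | s * #|[set x in A' | e x z]| < #|A|].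
have C'C : C' \subset C by apply/subsetP => x; rewrite inE => /andP[].
have [hC|hC] := leqP (3 * #|C|) (4 * #|C'|).
  apply: Or33; exists [:: (A', C')]; first by rewrite expn_gt0 s0.
  have bxE : setX A C :&: boxes [:: (A', C')] = setX A' C'.
    apply/setP => -[x z]; rewrite inE !in_setX [_ \in boxes _]inE /= orbF andbACA;
    by congr (_ && _); rewrite andb_idl //; apply: subsetP.
  rewrite /shatters bxE cardsX; apply/andP; split; first by move: hA' hC; nia.
  have h : s * #|edges_of :&: setX A' C'| <= #|C'| * #|A|.
    rewrite (_ : edges_of :&: _ = [set u : V * V | (u.2 \in C') && (u.1 \in A') && e u.1 u.2]).
      rewrite (@card_pairs_swap _ _ (fun x z => (z \in C') && (x \in A') && e x z)) big_distrr /=.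
      rewrite -sum_nat_const big_mkcond [X in _ <= X]big_mkcond /=.
      rewrite big_mkcond [X in _ <= X]big_mkcond /=.
      apply: leq_sum => z _; case: ifP => // zC'.
        move: (zC'); rewrite inE => /andP[_ /ltnW]; apply: leq_trans.
        rewrite leq_mul2l; apply/orP; right; apply/subset_leq_card/subsetP => x.
        by rewrite !inE => /andP[/andP[_ ->] ->].
      by rewrite (_ : [set x | _] = set0) ?cards0 ?muln0 //;
        apply/setP => x; rewrite !inE.
    by apply/setP => -[x z]; rewrite inE in_setX inE [RHS]inE /= andbC (andbC (x \in A')).
  rewrite -(leq_pmul2l s0); apply: leq_trans dAC.
  by have := subset_leq_card C'C; move: h; nia.
have hC'' : #|C| <= 4 * #|C :\: C'|.
  have : #|C| = #|C'| + #|C :\: C'|.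
    by rewrite -[LHS](cardsID C'); congr (_ + _); rewrite (setIidPr C'C).
  by move: hC; lia.
(* At least a quarter of C has #|A| / s or more neighbours in [A'], so [s] vertices of [A'] cover
   1/8 of C. As each [B' x] is at least half of B, the rectangles fill 1/16 of C x B. *)
have [||zs [zs1 zs2 zs3]] := @half_cover _ _ e (C :\: C') A' s.
- by move: A0 hA'; lia.
- move=> z; rewrite !inE negb_and -leqNgt => /andP[h zC]; rewrite zC /= in h.
  by apply: leq_trans h; apply: subset_leq_card.
apply: Or32; exists [seq ([set z | e x z], B' x) | x <- zs].
  by rewrite size_map (leq_trans zs1) // expnS leq_pmulr // expn_gt0 s0.
set L := [seq _ | _ <- _].
have bxE z : (z \in boxes L) = has (fun x => e x z.1 && (z.2 \in B' x)) zs.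
  by rewrite inE has_map; apply: eq_has => w /=; rewrite !inE.
apply/andP; split.
  set C2 := [set u in C :\: C' | has (e^~ u) zs] in zs3.
  suff : #|C2| * #|B| <= 2 * #|setX C B :&: boxes L| by move: zs3 hC''; nia.
  rewrite (_ : setX C B :&: boxes L = [set z : V * V | (z.1, z.2) \in setX C B :&: boxes L]).
    rewrite (@card_pairs _ _ (fun z y => (z, y) \in setX C B :&: boxes L)).
    rewrite -sum_nat_const big_distrr /= [X in _ <= X](bigID (mem C2)) /=.
    apply: leq_trans (leq_addr _ _); apply: leq_sum => z.
    rewrite !inE => /andP[/andP[_ zC] /hasP[x xzs xz]].
    have : #|B| <= 2 * #|B' x| by have := zs2 x xzs; rewrite inE => /andP[].
    move=> /leq_trans; apply; rewrite leq_mul2l /=; apply/subset_leq_card/subsetP => y yB'.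
    have yB : y \in B by move: yB'; rewrite inE => /andP[].
    rewrite inE inE in_setX zC yB bxE; apply/hasP; exists x => //=.
    by rewrite xz.
  by apply/setP => -[x y]; rewrite !inE.
(* In the rectangle of x, each y in [B' x] has fewer than #|C| / s^2 edges, since their other ends
   are common neighbours of x and y. *)
have h : s ^ 2 * #|[set z in edges_of :&: setX C B |
    has (fun x => e x z.1 && (z.2 \in B' x)) zs]| <= size zs * (#|B| * #|C|).
  apply: (@card_has_le _ _ (fun x z => e x z.1 && (z.2 \in B' x))) => x _.
  rewrite (_ : [set u in _ | _] = [set u : V * V | (u.2 \in B' x) && (u.1 \in cod (x, u.2))]).
    rewrite (@card_pairs_swap _ _ (fun z y => (y \in B' x) && (z \in cod (x, y)))) big_distrr /=.
    rewrite -sum_nat_const.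
    rewrite [X in _ <= X]big_mkcond /=.
    apply: leq_sum => y _; case: ifP => yB; last first.
      rewrite (_ : [set x | _] = set0) ?cards0 ?muln0 //; apply/setP => z.
      by rewrite inE [RHS]inE; apply/negP => /andP[]; rewrite inE yB.
    case: (boolP (y \in B' x)) => yB'; last first.
      by rewrite (_ : [set x | _] = set0) ?cards0 ?muln0 //;
        apply/setP => z; rewrite !inE.
    move: (yB'); rewrite inE => /andP[_ /ltnW]; apply: leq_trans.
    rewrite leq_mul2l; apply/orP; right; apply/subset_leq_card/subsetP => z.
    by rewrite inE.
  apply/setP => -[z y]; rewrite !inE /=.
  by case: (y \in B) => /=; rewrite ?andbF // andbT; case: (e z y); case: (z \in C);
     case: (e x z); rewrite ?andbF ?andbT.
have h2 : #|edges_of :&: (setX C B :&: boxes L)| <=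
   #|[set z in edges_of :&: setX C B | has (fun x => e x z.1 && (z.2 \in B' x)) zs]|.
  by apply/subset_leq_card/subsetP => z; rewrite setIA in_setI bxE => zL; rewrite inE.
rewrite -(leq_pmul2l s0); apply: leq_trans dCB.
have h3 : s * #|edges_of :&: (setX C B :&: boxes L)| <= #|B| * #|C|.
  rewrite -(leq_pmul2l s0) mulnA; apply: leq_trans (leq_trans h _).
    by rewrite leq_mul2l h2 orbT.
  by rewrite leq_mul2r zs1 orbT.
by move: h3; nia.
Qed.
End Shattering.

(** * Many edges lie in shattered pairs *)

Lemma card_sparse_cells (I S : finType) (E : {set I}) (P : I -> S) (k l : nat) :
  k * #|[set i in E | k * #|[set j in E | P j == P i]| < l * #|[set j | P j == P i]|]|
    <= l * #|I|.
Proof.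
rewrite -sum1_card (partition_big P predT) //= big_distrr /=.
rewrite -[#|I|]sum1_card [X in _ <= l * X](partition_big P predT) //= big_distrr /=.
apply: leq_sum => s _; rewrite !sum1dep_card.
have [h|h] := ltnP (k * #|[set j in E | P j == s]|) (l * #|[set j | P j == s]|).
  apply: leq_trans (ltnW h); rewrite leq_mul2l; apply/orP; right.
  by apply/subset_leq_card/subsetP => i; rewrite !inE => /andP[/andP[-> _] ->].
rewrite (_ : [set x | _] = set0) ?cards0 ?muln0 //; apply/setP => i; rewrite !inE.
by apply/negP => /andP[/andP[_ +] /eqP Pi]; rewrite Pi ltnNge h.
Qed.

Lemma card_small_cells (I S : finType) (P : I -> S) (k : nat) :
  k * #|[set i | k * #|[set j | P j == P i]| < #|I|]| <= #|S| * #|I|.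
Proof.
rewrite -sum1_card (partition_big P predT) //= big_distrr /= -sum_nat_const.
apply: leq_sum => s _; rewrite sum1dep_card.
have [h|h] := ltnP (k * #|[set j | P j == s]|) #|I|.
  apply: leq_trans (ltnW h); rewrite leq_mul2l; apply/orP; right.
  by apply/subset_leq_card/subsetP => i; rewrite !inE => /andP[_ ->].
rewrite (_ : [set x | _] = set0) ?cards0 ?muln0 //; apply/setP => i; rewrite !inE.
by apply/negP => /andP[+ /eqP Pi]; rewrite Pi ltnNge h.
Qed.

Section Refinement.
Variables (V : finType) (e : rel V).
Hypothesis e_sym : symmetric e.
Hypothesis tri_ex : forall x y, e x y -> exists z, e x z && e y z.
Hypothesis tri_uniq : forall x y z z',
  e x y -> e x z -> e y z -> e x z' -> e y z' -> z = z'.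

(* The apex of the triangle over an edge gives injections of the edge set into
   itself, one for each of the other two sides. *)
Lemma card_edges_cover (G : pred (V * V)) :
  (forall x y z, e x y -> e z y -> e x z -> [|| G (x, y), G (z, y) | G (x, z)]) ->
  #|edges_of e| <= 3 * #|[set z in edges_of e | G z]|.
Proof.
move=> hG; pose w (z : V * V) := odflt z.1 [pick w | e z.1 w && e z.2 w].
have wP z : e z.1 z.2 -> e z.1 (w z) && e z.2 (w z).
  by move=> /tri_ex[v hv]; rewrite /w; case: pickP => //= /(_ v); rewrite hv.
set GE := [set z in edges_of e | G z].
have preim (f : V * V -> V * V) : {in edges_of e &, injective f} ->
    {in edges_of e, forall z, f z \in edges_of e} ->
    #|[set z in edges_of e | G (f z)]| <= #|GE|.
  move=> finj fE; rewrite -(@card_in_imset _ _ f); last first.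
    by move=> x y; rewrite !inE => /andP[xE _] /andP[yE _]; apply: finj; rewrite inE.
  apply/subset_leq_card/subsetP => _ /imsetP[z + ->].
  by rewrite !inE => /andP[zE ->]; have := fE z; rewrite !inE => -> //.
have h1 := @preim (fun z => (w z, z.2)); have h2 := @preim (fun z => (z.1, w z)).
have -> : edges_of e = GE :|: ([set z in edges_of e | G (w z, z.2)]
                          :|: [set z in edges_of e | G (z.1, w z)]).
  apply/setP => -[x y]; rewrite !inE /= -!andb_orr.
  case: (boolP (e x y)) => // xy; have /andP[/= h h'] := wP (x, y) xy.
  by rewrite hG // e_sym.
do 2!rewrite (leq_trans (leq_card_setU _ _)) // mulSn leq_add //.
  apply: h1; last by move=> z; rewrite !inE /= => /wP /andP[_]; rewrite e_sym.
  move=> [x y] [x' y']; rewrite !inE /= => /[dup] xy /(wP (_, _)) /andP[/= xw yw].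
  move=> /[dup] xy' /(wP (_, _)) /andP[/= xw' yw'] [ww yy]; subst y'.
  rewrite -ww in xw' yw'; congr (_, _).
  by apply: (tri_uniq (x := w (x, y)) (y := y)); rewrite // e_sym.
rewrite mul1n; apply: h2; last by move=> z; rewrite !inE /= => /wP /andP[].
move=> [x y] [x' y']; rewrite !inE /= => /[dup] xy /(wP (_, _)) /andP[/= xw yw].
move=> /[dup] xy' /(wP (_, _)) /andP[/= xw' yw'] [xx ww]; subst x'.
rewrite -ww in xw' yw'; congr (_, _).
by apply: (tri_uniq (x := x) (y := w (x, y))); rewrite // e_sym.
Qed.

Definition pairmap (T : Type) (p : V -> T) (z : V * V) : T * T := (p z.1, p z.2).

Lemma pairmap_cell (T : finType) (p : V -> T) (a : T * T) :
  [set z | pairmap p z == a] = setX [set v | p v == a.1] [set v | p v == a.2].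
Proof. by apply/setP => z; rewrite !inE; case: a => s t; rewrite xpair_eqE. Qed.

Lemma pairmap_edge_cell (T : finType) (p : V -> T) (a : T * T) :
  [set z in edges_of e | pairmap p z == a] =
    edges_of e :&: setX [set v | p v == a.1] [set v | p v == a.2].
Proof. by rewrite -pairmap_cell; apply/setP => z; rewrite !inE. Qed.

(** Every triangle has a side that is sparse, has an endpoint in a small cell, or is shattered, so
    such sides make up a third of the edges. Density below 64 / s = 1 / (20 q) accounts for 1/20 of
    the edges, and small cells for 1/40 at either endpoint; this leaves 1/3 - 1/10 > 1/5. *)
Lemma card_shattered_edges (T : finType) (p : V -> T) (q : nat) (sh : pred (T * T)) :
  0 < q -> #|V| ^ 2 <= q * #|edges_of e| -> (1280 * q * #|T|) ^ 5 <= #|V| ->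
  (forall a L, size L <= (1280 * q) ^ 2 ->
     shatters e [set v | p v == a.1] [set v | p v == a.2] L -> sh a) ->
  #|edges_of e| <= 5 * #|[set z in edges_of e | sh (pairmap p z)]|.
Proof.
move=> q0 hq hT hsh; set E := edges_of e; set s := 1280 * q in hT hsh.
pose cell (a : T) := [set v | p v == a].
pose sparse (z : V * V) := s * #|E :&: setX (cell (p z.1)) (cell (p z.2))|
   < 64 * (#|cell (p z.1)| * #|cell (p z.2)|).
pose small (v : V) := 40 * q * #|T| * #|cell (p v)| < #|V|.
have [->|E0] := posnP #|E|; first by [].
have V0 : 0 < #|V|.
  by case/card_gt0P: E0 => -[x y] _; apply/card_gt0P; exists x.
have T0 : 0 < #|T|.
  by case/card_gt0P: V0 => x _; apply/card_gt0P; exists (p x).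
have : #|E| <= 3 * #|[set z in E | [|| sparse z, small z.1, small z.2 | sh (pairmap p z)]]|.
  apply: card_edges_cover.
  move=> x y z xy zy xz; rewrite /pairmap /=.
  case: (boolP (small x)) => [_|sx]; first by rewrite ?orbT.
  case: (boolP (small y)) => [_|sy]; first by rewrite ?orbT.
  case: (boolP (small z)) => [_|sz]; first by rewrite ?orbT.
  case: (boolP (sparse (x, y))) => [//|dxy].
  case: (boolP (sparse (z, y))) => [|dzy]; first by rewrite ?orbT.
  case: (boolP (sparse (x, z))) => [|dxz]; first by rewrite ?orbT.
  have cell0 v : 0 < #|cell (p v)| by apply/card_gt0P; exists v; rewrite inE.
  move: dxy dzy dxz; rewrite /sparse /= -!leqNgt => dxy dzy dxz.
  (* Both cells have at least #|V| / (s #|T|) vertices, and #|V| >= (s #|T|)^5. *)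
  have big : s ^ 3 * #|V| <= #|cell (p x)| * #|cell (p y)|.
    move: sx sy; rewrite /small -!leqNgt; set c := _ * _ * #|T| => sx sy.
    have c0 : 0 < c ^ 2 by rewrite expn_gt0 !muln_gt0 q0 T0.
    rewrite -(leq_pmul2l c0); apply: (@leq_trans (#|V| * #|V|)); last first.
      by apply: leq_trans (leq_mul sx sy) _; lia.
    apply: leq_trans (leq_mul hT (leqnn _)); rewrite mulnA leq_mul2r; apply/orP; right.
    rewrite [X in _ <= X](_ : _ = (s * #|T|) ^ 2 * (s ^ 3 * #|T| ^ 3)); last first.
      by rewrite -expnMn -expnD.
    rewrite leq_mul //; last by rewrite leq_pmulr // expn_gt0 T0.
    by rewrite leq_sqr leq_mul2r leq_mul2r orbT orbT.
  have [[L L1 L2]|[L L1 L2]|[L L1 L2]] :=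
    shattering_triple tri_uniq (cell0 x) (cell0 y) (cell0 z) dxy dzy dxz big.
  - by rewrite (hsh (p x, p y) L) ?orbT.
  - by rewrite (hsh (p z, p y) L) ?orbT.
  - by rewrite (hsh (p x, p z) L) ?orbT.
set Sh := [set z in E | sh _].
have hsp : 20 * #|[set z in E | sparse z]| <= #|E|.
  have := card_sparse_cells E (pairmap p) s 64.
  rewrite card_prod -[X in _ <= 64 * X]/(#|V| ^ 2).
  rewrite (_ : [set _ in E | _] = [set z in E | sparse z]).
    by rewrite /s; move: hq q0; rewrite -/E; nia.
  by apply/setP => z; rewrite !inE pairmap_edge_cell pairmap_cell cardsX.
have hsm : 40 * #|[set v | small v]| * #|V| <= #|E|.
  have := card_small_cells p (40 * q * #|T|); rewrite -/(small _) => h.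
  have {}h : 40 * q * #|[set v | small v]| <= #|V|.
    by rewrite -(leq_pmul2l T0); apply: leq_trans h; rewrite mulnA (mulnC #|T|).
  rewrite -(leq_pmul2l q0); apply: leq_trans hq.
  by rewrite expnS expn1 !mulnA (mulnC q) leq_mul2r h orbT.
have hsm1 : #|[set z in E | small z.1]| <= #|[set v | small v]| * #|V|.
  rewrite -cardsT -cardsX; apply/subset_leq_card/subsetP => z.
  by rewrite !inE => /andP[_ ->].
have hsm2 : #|[set z in E | small z.2]| <= #|[set v | small v]| * #|V|.
  rewrite mulnC -cardsT -cardsX; apply/subset_leq_card/subsetP => z.
  by rewrite !inE => /andP[_ ->].
have : #|[set z in E | [|| sparse z, small z.1, small z.2 | sh (pairmap p z)]]|
    <= #|[set z in E | sparse z]| + (#|[set z in E | small z.1]|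
       + (#|[set z in E | small z.2]| + #|Sh|)).
  rewrite (_ : [set z in E | _] = [set z in E | sparse z] :|: ([set z in E | small z.1]
     :|: ([set z in E | small z.2] :|: Sh))).
    by do 3!(apply: leq_trans (leq_card_setU _ _) _; rewrite leq_add2l).
  by apply/setP => z; rewrite !inE -!andb_orr.
rewrite -/E; lia.
Qed.
End Refinement.

(** * Energy increment *)

(* Each of the m cells is split by the 2 B^2 sides of the rectangles chosen for
   each of the m^2 pairs of cells. *)
Definition refined_size (B m : nat) := m * (4 ^ (B ^ 2)) ^ (m ^ 2).

Section Increment.
Variables (R : realType) (V : finType) (e : rel V).
Local Notation E := (edges_of e).

(** The new cell of a vertex records which sides of all the rectangles contain it. The rectangles in
    a shattered pair are then unions of pairs of new cells, and [energy_refine] applies with [Q]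
    selecting these. *)
Lemma energy_shatter (T : finType) (p : V -> T) (K : nat) (sh : pred (T * T))
    (F : T * T -> seq ({set V} * {set V})) :
  (forall a, sh a -> size (F a) <= K) ->
  (forall a, sh a -> shatters e [set v | p v == a.1] [set v | p v == a.2] (F a)) ->
  exists (T' : finType) (p' : V -> T'),
   #|T'| = #|T| * (4 ^ K) ^ (#|T| ^ 2) /\
   (energy R E (pairmap p) + #|[set z in E | sh (pairmap p z)]|%:R / 64 <=
    energy R E (pairmap p'))%R.
Proof.
move=> hK hsh; pose S := {ffun T * T -> {ffun 'I_K -> bool * bool}}.
(* The default pads each list to length [K] with empty rectangles. *)
pose r a i := nth (set0, set0) (F a) i.
pose p' u : T * S :=
  (p u, [ffun a => [ffun i : 'I_K => (u \in (r a i).1, u \in (r a i).2)]]).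
exists (T * S)%type, p'; split.
  by rewrite card_prod !card_ffun !card_prod card_bool card_ord mulnn.
pose Q (b : (T * S) * (T * S)) := let a := (b.1.1, b.2.1) in
  sh a && [exists i, (b.1.2 a i).1 && (b.2.2 a i).2].
pose f (b : (T * S) * (T * S)) := (b.1.1, b.2.1).
have QE z : Q (pairmap p' z) = sh (pairmap p z) && (z \in boxes (F (pairmap p z))).
  rewrite /Q /=; case: (boolP (sh _)) => //= hz; rewrite inE; set a := pairmap p z in hz *.
  apply/existsP/hasP => [[i]|[b /(nthP (set0, set0))[i iF <-] zb]].
    rewrite !ffunE /= => h; exists (r a i) => //; apply: mem_nth.
    rewrite ltnNge; apply/negP => iF; move: h.
    by rewrite /r nth_default //= inE.
  exists (Ordinal (leq_trans iF (hK _ hz))); by rewrite !ffunE /=.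
have := @energy_refine R _ E _ _ (pairmap p) (pairmap p') f Q (fun=> erefl).
set A := (\sum_(i | _) _)%R; set B := #|[set i in E | Q _]|; set C := #|[set z in E | sh _]|.
move=> h; suff : (0 <= 3 / 4 * A - 2 * B%:R - C%:R / 64 :> R)%R by move: h; lra.
rewrite /A (partition_big (pairmap p) predT) //= /B -sum1_card natr_sum.
rewrite (partition_big (pairmap p) predT) //= /C -sum1_card natr_sum.
rewrite (partition_big (pairmap p) predT) //= !(mulr_sumr, mulr_suml) -!sumrB.
apply: sumr_ge0 => a _.
rewrite -!natr_sum !sum1dep_card.
have [sha|sha] := boolP (sh a); last first.
  rewrite big_pred0 ?mulr0; last first.
    move=> z; rewrite QE; apply/negP => /andP[/andP[+ _] /eqP za].
    by rewrite za (negPf sha).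
  rewrite [X in (_ - _ * #|pred_of_set X|%:R - _)%R](_ : _ = set0); last first.
    apply/setP => z; rewrite !inE QE; apply/negP => /andP[/and3P[_ + _] /eqP za].
    by rewrite za (negPf sha).
  rewrite [X in (_ - #|pred_of_set X|%:R / _)%R](_ : _ = set0); last first.
    apply/setP => z; rewrite !inE; apply/negP => /andP[/andP[_ +] /eqP za].
    by rewrite za (negPf sha).
  by rewrite cards0 mulr0 mul0r !subr0.
pose X := setX [set v | p v == a.1] [set v | p v == a.2].
pose U := X :&: boxes (F a).
have cellE z : (pairmap p z == a) = (z \in X) by rewrite /X -pairmap_cell inE.
have UE z : Q (pairmap p' z) && (pairmap p z == a) = (z \in U).
  rewrite QE [z \in U]inE -cellE andbC; case: eqP => //= ->.
  by rewrite sha.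
rewrite (eq_bigr (fun=> density R E (pairmap p) a)); last by move=> z /andP[_ /eqP->].
rewrite (eq_bigl (mem U)) // sumr_const.
rewrite [X in (_ - _ * #|pred_of_set X|%:R - _)%R](_ : _ = E :&: U); last first.
  by apply/setP => z; rewrite !inE -andbA UE !inE.
rewrite [X in (_ - #|pred_of_set X|%:R / _)%R](_ : _ = E :&: X); last first.
  apply/setP => z; rewrite in_setI -cellE inE [z \in [set _ in E | _]]inE.
  by case: eqP => [->|]; rewrite ?sha ?andbT ?andbF.
(* The pair [a] gains at least 3/4 * 1/16 - 2/64 = 1/64 of its edges. *)
have := densityM R E (pairmap p) a; have := density_ge0 R E (pairmap p) a.
rewrite pairmap_cell pairmap_edge_cell -/X; set d := density _ _ _ _ => d0 dX.
have /andP[] := hsh a sha; rewrite -cardsX -/X -/U => h1 h2.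
rewrite -[(d *+ _)%R]mulr_natr.
have : (#|X|%:R <= 16 * #|U|%:R :> R)%R by rewrite -natrM ler_nat.
have : (64 * #|E :&: U|%:R <= #|E :&: X|%:R :> R)%R by rewrite -natrM ler_nat.
nra.
Qed.

Hypothesis e_sym : symmetric e.
Hypothesis tri_ex : forall x y, e x y -> exists z, e x z && e y z.
Hypothesis tri_uniq : forall x y z z',
  e x y -> e x z -> e y z -> e x z' -> e y z' -> z = z'.

(** A fifth of the edges lies in shattered pairs, and each such edge contributes 1/64. *)
Lemma energy_increment (T : finType) (p : V -> T) (q : nat) :
  0 < q -> #|V| ^ 2 <= q * #|E| -> (1280 * q * #|T|) ^ 5 <= #|V| ->
  exists (T' : finType) (p' : V -> T'),
    #|T'| = refined_size (1280 * q) #|T| /\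
    (energy R E (pairmap p) + #|E|%:R / 320 <= energy R E (pairmap p'))%R.
Proof.
move=> q0 hq hT; set K := (1280 * q) ^ 2.
pose ok (a : T * T) L :=
  (size L <= K) && shatters e [set v | p v == a.1] [set v | p v == a.2] L.
(* [F] picks a shattering list for every pair that has a short one, so a pair is shattered exactly
   if [F] succeeds on it. *)
have /boolp.choice[F hF] : forall a, exists b, forall L, ok a L -> ok a b.
  move=> a; have [[L hL]|hn] := EM (exists L, ok a L); first by exists L.
  by exists [::] => L hL; case: hn; exists L.
have [||T' [p' [h1 h2]]] := @energy_shatter T p K (fun a => ok a (F a)) F.
- by move=> a /andP[].
- by move=> a /andP[].
exists T', p'; split => //; apply: le_trans h2; rewrite lerD2l.
have h := @card_shattered_edges V e e_sym tri_ex tri_uniq T p q (fun a => ok a (F a)) q0 hq hT.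
have {h} := h (fun a L L1 L2 => hF a L (introT andP (conj L1 L2))).
set sh := #|[set _ in E | _]| => h.
have : (#|E|%:R <= 5 * sh%:R :> R)%R by rewrite -natrM ler_nat.
lra.
Qed.

Lemma energy_iterate (q i : nat) :
  0 < q -> #|V| ^ 2 <= q * #|E| -> 0 < #|E| ->
  (forall j, j < i -> (1280 * q * iter j (refined_size (1280 * q)) 1) ^ 5 <= #|V|) ->
  exists (T : finType) (p : V -> T), #|T| = iter i (refined_size (1280 * q)) 1 /\
    (- #|E|%:R * ln q%:R + i%:R * (#|E|%:R / 320) <= energy R E (pairmap p))%R.
Proof.
move=> q0 hq E0; elim: i => [|i IH] hi.
  (* The trivial partition has energy #|E| ln (#|E| / #|V|^2) >= - #|E| ln q. *)
  exists unit, (fun=> tt); rewrite card_unit; split => //; rewrite mul0r addr0.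
  rewrite (_ : pairmap _ = fun=> (tt, tt)) //.
  have -> : energy R E (fun=> (tt, tt)) = energy R E (fun=> tt).
    rewrite /energy; apply: eq_bigr => z _; congr (_ * ln _)%R;
    rewrite /density; congr (_%:R / _%:R)%R; apply: eq_card => y; rewrite !inE //.
  have VV0 : 0 < #|V| ^ 2.
    case/card_gt0P: E0 => -[x y] _; rewrite expn_gt0; apply/orP; left.
    by apply/card_gt0P; exists x.
  rewrite energy_const -?card_gt0 // card_prod mulnn mulNr -mulrN.
  rewrite ler_wpM2l // -lnV ?posrE ?ltr0n // ler_ln ?posrE ?invr_gt0 ?ltr0n //.
    by rewrite ler_pdivlMr ?ltr0n // ler_pdivrMl ?ltr0n // -natrM ler_nat.
  by rewrite divr_gt0 ?ltr0n.
have [|T [p [h1 h2]]] := IH; first by move=> j ji; apply: hi; rewrite ltnS ltnW.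
have [|T' [p' [h3 h4]]] := @energy_increment T p q q0 hq; first by rewrite h1 hi.
exists T', p'; split; first by rewrite h3 h1.
apply: le_trans h4; rewrite -natr1 mulrDl mul1r addrA lerD2r; exact: h2.
Qed.

(** Otherwise 320 k + 1 refinements would be possible and raise the energy to at least #|E| (k +
    1/320 - k ln 2), which is positive as ln 2 <= 1. *)
Lemma few_edges (k : nat) :
  #|V| ^ 2 <= 2 ^ k * #|E| -> 0 < #|V| ->
  exists2 j, j <= 320 * k & #|V| < (1280 * 2 ^ k * iter j (refined_size (1280 * 2 ^ k)) 1) ^ 5.
Proof.
move=> hq V0; have q0 : 0 < 2 ^ k by rewrite expn_gt0.
have E0 : 0 < #|E|.
  by move: hq; case: #|E| => //; rewrite muln0 leqn0 expn_eq0 andbT -leqn0 leqNgt V0.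
set g := fun j => (1280 * 2 ^ k * iter j (refined_size (1280 * 2 ^ k)) 1) ^ 5.
case: (boolP [exists j : 'I_(320 * k).+1, #|V| < g j]) => [/existsP[j hj]|hn].
  by exists (val j); [rewrite -ltnS ltn_ord | exact: hj].
have [|T [p [_ h]]] := @energy_iterate (2 ^ k) (320 * k).+1 q0 hq E0.
  move=> j hj; rewrite leqNgt; apply: contra hn => h.
  by apply/existsP; exists (Ordinal hj).
have := le_trans h (energy_le0 _ _ _).
rewrite natrX lnXn // -(natr1 (320 * k)) natrM => {}h.
have : (0 < #|E|%:R :> R)%R by rewrite ltr0n.
have := ln2_le1 R; rewrite -mulr_natr in h; have : (0 <= k%:R :> R)%R by [].
move: h; set c := #|E|%:R%R; set l := ln 2; set kk := k%:R%R => h k0 l1 c0.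
have : (0 <= c * (kk * (1 - l)))%R by rewrite !mulr_ge0 ?subr_ge0 // ltW.
nra.
Qed.
End Increment.

(** * Towers and the iterated logarithm *)

Definition tower (h : nat) : nat := iter h (expn 2) 1.

Lemma towerS h : tower h.+1 = 2 ^ tower h. Proof. by []. Qed.

Lemma leq_tower : {homo tower : m n / m <= n}.
Proof.
apply: homo_leq => // [n m p|h]; first exact: leq_trans.
by rewrite towerS ltnW // ltn_expl.
Qed.

Lemma leq_tower_id h : h <= tower h.
Proof. by elim: h => // h IH; apply: leq_ltn_trans IH _; rewrite towerS ltn_expl. Qed.

(** With t = tower h the size is at most 2^(t + 2 t^4), and t + 2 t^4 <= 2^(4 t + 2) <= 2^(2^t); h
    >= 3 gives t >= 16, enough for 4 t + 2 <= 2^t. *)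
Lemma tower_refined_size (B h m : nat) : 3 <= h -> B <= tower h -> m <= tower h ->
  refined_size B m <= tower h.+3.
Proof.
move=> h3 Bh mh; set t := tower h in Bh mh *.
have t16 : 16 <= t by apply: (leq_tower h3).
have tt : t < 2 ^ t by rewrite ltn_expl.
have t2 : 4 * t + 2 <= 2 ^ t.
  have [k ->] : exists k, t = 5 + k by exists (t - 5); lia.
  by rewrite expnD (_ : 2 ^ 5 = 32) //; elim: k => // k IH; rewrite expnS; lia.
rewrite /refined_size.
apply: (@leq_trans (2 ^ t * (4 ^ (t ^ 2)) ^ (t ^ 2))).
  apply: leq_mul; first exact: leq_trans mh (ltnW tt).
  rewrite -!expnM leq_exp2l //; apply: leq_mul; rewrite leq_sqr //.
have -> : (4 ^ (t ^ 2)) ^ (t ^ 2) = 2 ^ (2 * t ^ 4).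
  by rewrite -[4]/(2 ^ 2) -!expnM; rewrite (expnD t 2 2) mulnA.
rewrite -expnD !towerS -/t leq_exp2l //.
apply: (@leq_trans (2 ^ (4 * t + 2))); last by rewrite leq_exp2l.
have t4 : t ^ 4 <= 2 ^ (4 * t).
  by rewrite mulnC expnM leq_exp2r // ltnW.
have : t * 1 <= t * t ^ 3 by rewrite leq_mul2l expn_gt0; lia.
rewrite -expnS muln1 expnD => t1; move: t4 t1; move: (t ^ 4) (2 ^ (4 * t)) => a b.
rewrite (_ : 2 ^ 2 = 4) //; lia.
Qed.

Lemma tower_power5 (B h m : nat) : 3 <= h -> B <= tower h -> m <= tower h ->
  (B * m) ^ 5 <= tower h.+2.
Proof.
move=> h3 Bh mh; set t := tower h in Bh mh *.
have t16 : 16 <= t by apply: (leq_tower h3).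
have tt : t < 2 ^ t by rewrite ltn_expl.
have t2 : 10 * t <= 2 ^ t.
  have [k ->] : exists k, t = 6 + k by exists (t - 6); lia.
  by rewrite expnD (_ : 2 ^ 6 = 64) //; elim: k => // k IH; rewrite expnS; lia.
apply: (@leq_trans ((2 ^ t * 2 ^ t) ^ 5)).
  by rewrite leq_exp2r // leq_mul // ltnW // (leq_ltn_trans _ tt).
by rewrite -expnD -expnM !towerS -/t leq_exp2l //; lia.
Qed.

(** Height k + 12 suffices for 1280 * 2^k, each refinement adds 3 and the fifth power 2, in total k
    + 12 + 960 k + 2. *)
Lemma tower_iter (k j : nat) : j <= 320 * k ->
  (1280 * 2 ^ k * iter j (refined_size (1280 * 2 ^ k)) 1) ^ 5 <= tower (961 * k + 14).
Proof.
move=> jk; have hB h : k + 12 <= h -> 1280 * 2 ^ k <= tower h.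
  move=> kh; apply: leq_trans (leq_tower kh); rewrite addnS towerS.
  apply: (@leq_trans (2 ^ (k + 11))); first by rewrite expnD mulnC leq_mul2l orbT.
  by rewrite leq_exp2l // leq_tower_id.
have hm i : iter i (refined_size (1280 * 2 ^ k)) 1 <= tower (k + 12 + 3 * i).
  elim: i => [|i IH] /=.
    by apply: leq_trans (leq_tower (leq0n _)).
  rewrite mulnS addnCA; apply: tower_refined_size => //; first by lia.
  by apply: hB; lia.
apply: leq_trans (tower_power5 _ (hB (k + 12 + 3 * j) _) (hm j)) _; try lia.
by apply: leq_tower; lia.
Qed.

Section LogStar.
Variable R : realType.
Implicit Type x : R.
Local Open Scope ring_scope.

Lemma iter_log2_le1E x h : (iter h (@log2 R) x <= 1) = (x <= (tower h)%:R).
Proof.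
elim: h x => [|h IH] x //=; rewrite -iterS iterSr IH /log2.
have l2 : 0 < ln 2 :> R by rewrite ln_gt0 // ltr1n.
rewrite ler_pdivrMr // mulr_natl -lnXn // -natrX.
have [x0|x0] := ltP 0 x; first by rewrite ler_ln ?posrE // ltr0n expn_gt0.
(* For x <= 0 both sides hold, because [ln] is 0 there. *)
by rewrite ln0 // (le_trans x0) // ln_ge0 // ler1n expn_gt0.
Qed.

Lemma logstar_le x h : (logstar x <= h)%N = (x <= (tower h)%:R).
Proof.
rewrite /logstar; case: ex_minnP => m; rewrite iter_log2_le1E => hm hmin.
apply/idP/idP => [mh|]; last by rewrite -iter_log2_le1E; apply: hmin.
by apply: (le_trans hm); rewrite ler_nat leq_tower.
Qed.
End LogStar.

(** * Matrix multiplication *)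

Local Open Scope ring_scope.

Section MatmulSupport.
Variables (F : fieldType) (N : nat).

Local Notation triple := ('I_N * 'I_N * 'I_N)%type.

Definition matmul_index (t : triple) : ('I_N * 'I_N) * ('I_N * 'I_N) * ('I_N * 'I_N) :=
  ((t.1.1, t.1.2), (t.1.2, t.2), (t.2, t.1.1)).

Lemma matmul_tensorE u : matmul_tensor F N u = \sum_t (u == matmul_index t)%:R.
Proof.
rewrite /matmul_tensor sum_ffunE.
under eq_bigr => i _ do rewrite sum_ffunE.
under eq_bigr => i _ do under eq_bigr => j _ do rewrite sum_ffunE.
under eq_bigr => i _ do under eq_bigr => j _ do under eq_bigr => k _ do rewrite ffunE.
rewrite pair_bigA pair_bigA /=.
by apply: eq_bigr => -[[i j] k] _.
Qed.

Lemma matmul_index_inj : injective matmul_index.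
Proof. by move=> [[i j] k] [[i' j'] k'] [-> -> _ -> _]. Qed.

Lemma matmul_tensor_neq0 u : (matmul_tensor F N u != 0) = (u \in codom matmul_index).
Proof.
rewrite matmul_tensorE; apply/idP/codomP => [|[t ->]].
  case: (pickP (fun t => u == matmul_index t)) => [t /eqP -> _|hu]; first by exists t.
  by rewrite big1 ?eqxx // => t _; rewrite hu.
rewrite (bigD1 t) //= eqxx big1 ?addr0 ?oner_neq0 // => t' /negPf tt.
by rewrite (inj_eq matmul_index_inj) eq_sym tt.
Qed.

Definition incident (t : triple) (v : 'I_N + 'I_N + 'I_N) : bool :=
  match v with
  | inl (inl i) => t.1.1 == i
  | inl (inr j) => t.1.2 == j
  | inr k => t.2 == k
  end.

(** Each triple (i, j, k) of [M] spans a triangle on three disjoint copies of the index set;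
    [u != v] excludes loops. *)
Definition triangle_graph (M : {set triple}) : rel ('I_N + 'I_N + 'I_N) :=
  fun u v => (u != v) && [exists t in M, incident t u && incident t v].

(** [M] consists of the triples whose three pairs lie in A', B' and C'. A pair that occurs in some
    triple of [M] lies in its set, which gives the closure property; the identity condition on the
    three axes gives the injectivity. *)
Lemma perm_identity_triples (k : nat) A' B' C' :
  is_perm_identity (zero_out (matmul_tensor F N) A' B' C') k ->
  exists M : {set triple}, [/\ #|M| = k,
    {in M &, forall s t : triple, s.1 = t.1 -> s = t},
    {in M &, forall s t : triple, s.1.2 = t.1.2 -> s.2 = t.2 -> s = t},
    {in M &, forall s t : triple, s.2 = t.2 -> s.1.1 = t.1.1 -> s = t}
   & forall i j k, (exists k', (i, j, k') \in M) -> (exists i', (i', j, k) \in M) ->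
       (exists j', (i, j', k) \in M) -> (i, j, k) \in M].
Proof.
set T := zero_out _ _ _ _; case/and4P => /eqP Tk /forallP hA /forallP hB /forallP hC.
pose M := [set t : triple | matmul_index t \in tsupp T].
have inM i j k' : ((i, j, k') \in M) = [&& (i, j) \in A', (j, k') \in B' & (k', i) \in C'].
  rewrite !inE ffunE /=; case: ifP => _; last by rewrite eqxx.
  by rewrite matmul_tensor_neq0 codom_f.
have sub u : u \in tsupp T -> exists2 t, t \in M & u = matmul_index t.
  move=> uT; move: (uT); rewrite inE ffunE; case: ifP; rewrite ?eqxx // => _.
  by rewrite matmul_tensor_neq0 => /codomP[t ut]; exists t; rewrite // inE -ut.
have uniq (f : ('I_N * 'I_N) * ('I_N * 'I_N) * ('I_N * 'I_N) -> 'I_N * 'I_N) :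
   (forall a, #|[set u in tsupp T | f u == a]| <= 1)%N ->
   {in M &, forall s t, f (matmul_index s) = f (matmul_index t) -> s = t}.
  move=> h s t sM tM fst; apply: matmul_index_inj.
  have cM r : r \in M -> matmul_index r \in tsupp T by rewrite inE.
  have /card_le1_eqP := h (f (matmul_index s)); apply; rewrite inE cM //= ?eqxx //.
  by rewrite fst.
exists M; split.
- rewrite -Tk -(card_imset _ matmul_index_inj); apply: eq_card => u; apply/imsetP/idP.
    by move=> [t + ->]; rewrite inE.
  by move/sub => [t tM ->]; exists t.
- by move=> s t sM tM st; apply: (uniq (fun u => u.1.1) hA) => //=; rewrite st.
- by move=> s t sM tM s1 s2; apply: (uniq (fun u => u.1.2) hB) => //=; rewrite s1 s2.
- by move=> s t sM tM s1 s2; apply: (uniq (fun u => u.2) hC) => //=; rewrite s1 s2.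
- move=> i j k' [k1 h1] [i1 h2] [j1 h3]; move: h1 h2 h3; rewrite !inM.
  by move=> /and3P[-> _ _] /and3P[_ -> _] /and3P[_ _ ->].
Qed.

(** * Each edge of the graph lies in exactly one triangle *)

Section TriangleGraph.
Variable M : {set triple}.
Hypothesis M12 : {in M &, forall s t : triple, s.1 = t.1 -> s = t}.
Hypothesis M23 : {in M &, forall s t : triple, s.1.2 = t.1.2 -> s.2 = t.2 -> s = t}.
Hypothesis M31 : {in M &, forall s t : triple, s.2 = t.2 -> s.1.1 = t.1.1 -> s = t}.
Hypothesis Mclosed : forall i j k, (exists k', (i, j, k') \in M) ->
  (exists i', (i', j, k) \in M) -> (exists j', (i, j', k) \in M) -> (i, j, k) \in M.

Local Notation e := (triangle_graph M).

Lemma triangle_graph_sym : symmetric e.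
Proof.
move=> u v; rewrite /triangle_graph eq_sym; congr (_ && _).
by apply: eq_existsb => t; rewrite (andbC (incident t u)).
Qed.

Lemma triangle_graphP u v : e u v ->
  match u, v with
  | inl (inl i), inl (inr j) => exists k, (i, j, k) \in M
  | inl (inr j), inl (inl i) => exists k, (i, j, k) \in M
  | inl (inr j), inr k => exists i, (i, j, k) \in M
  | inr k, inl (inr j) => exists i, (i, j, k) \in M
  | inl (inl i), inr k => exists j, (i, j, k) \in M
  | inr k, inl (inl i) => exists j, (i, j, k) \in M
  | _, _ => False
  end.
Proof.
case/andP=> uv /exists_inP[[[i j] k] tM /andP[/=]].
by case: u v uv => [[i'|j']|k'] [[i''|j'']|k''] /= uv /eqP eu /eqP ev; subst;
  first [by rewrite eqxx in uv | by eexists; eassumption].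
Qed.

Lemma triangle_graphI t u v : t \in M -> incident t u -> incident t v -> u != v -> e u v.
Proof.
by move=> tM tu tv uv; apply/andP; split => //; apply/exists_inP; exists t; rewrite ?tu.
Qed.

Lemma triangle_graph_ex u v : e u v -> exists w, e u w && e v w.
Proof.
have key i j k : (i, j, k) \in M ->
  [/\ e (inl (inl i)) (inl (inr j)), e (inl (inr j)) (inr k) & e (inl (inl i)) (inr k)].
  by move=> tM; split; apply: (triangle_graphI tM); rewrite //= eqxx.
move/triangle_graphP; case: u v => [[i|j]|k] [[i'|j']|k'] // [x /key[h1 h2 h3]];
  [exists (inr x)|exists (inl (inr x))|exists (inr x)|exists (inl (inl x))
  |exists (inl (inr x))|exists (inl (inl x))];
  by rewrite ?h1 ?h2 ?h3 //= triangle_graph_sym ?h1 ?h2 ?h3 //=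
    triangle_graph_sym ?h1 ?h2 ?h3.
Qed.

(** By closure a triangle of the graph is a triple of [M], and two triangles on one edge are triples
    agreeing in two coordinates. [X], [Y] and [Z] treat the three positions of the remaining one. *)
Lemma triangle_graph_uniq u v w w' :
  e u v -> e u w -> e v w -> e u w' -> e v w' -> w = w'.
Proof.
have X i j k k' : (exists k0, (i, j, k0) \in M) ->
  (exists i0, (i0, j, k) \in M) -> (exists j0, (i, j0, k) \in M) ->
  (exists i0, (i0, j, k') \in M) -> (exists j0, (i, j0, k') \in M) -> k = k'.
  move=> h h1 h2 h3 h4; have := M12 (Mclosed h h1 h2) (Mclosed h h3 h4) erefl.
  by case.
have Y i i' j k : (exists i0, (i0, j, k) \in M) ->
  (exists k0, (i, j, k0) \in M) -> (exists j0, (i, j0, k) \in M) ->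
  (exists k0, (i', j, k0) \in M) -> (exists j0, (i', j0, k) \in M) -> i = i'.
  move=> h h1 h2 h3 h4; have := M23 (Mclosed h1 h h2) (Mclosed h3 h h4) erefl erefl.
  by case.
have Z i j j' k : (exists j0, (i, j0, k) \in M) ->
  (exists k0, (i, j, k0) \in M) -> (exists i0, (i0, j, k) \in M) ->
  (exists k0, (i, j', k0) \in M) -> (exists i0, (i0, j', k) \in M) -> j = j'.
  move=> h h1 h2 h3 h4; have := M31 (Mclosed h1 h2 h) (Mclosed h3 h4 h) erefl erefl.
  by case.
move=> /triangle_graphP uv /triangle_graphP uw /triangle_graphP vw.
move=> /triangle_graphP uw' /triangle_graphP vw'.
case: u v w w' uv uw vw uw' vw' => [[i|j]|k] [[i'|j']|k'] [[a|a]|a] [[b|b]|b] //;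
  move=> h1 h2 h3 h4 h5.
all: try by congr (inr _); eapply X; eauto.
all: try by congr (inl (inl _)); eapply Y; eauto.
all: try by congr (inl (inr _)); eapply Z; eauto.
Qed.

Lemma card_triangle_graph : (#|M| <= #|edges_of e|)%N.
Proof.
pose f (t : triple) : ('I_N + 'I_N + 'I_N) * ('I_N + 'I_N + 'I_N) :=
  (inl (inl t.1.1), inl (inr t.1.2)).
rewrite -(@card_in_imset _ _ f M); last first.
  move=> s t sM tM [h1 h2]; apply: M12 => //.
  by case: s t h1 h2 {sM tM} => [[? ?] ?] [[? ?] ?] /= -> ->.
apply/subset_leq_card/subsetP => _ /imsetP[t tM ->]; rewrite inE /=.
by apply: (triangle_graphI tM); rewrite //= eqxx.
Qed.
End TriangleGraph.
End MatmulSupport.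

(** * The bound for the subrank *)

Lemma perm_identity_bound (R : realType) (F : fieldType) (N k j : nat) A' B' C' :
  is_perm_identity (zero_out (matmul_tensor F N) A' B' C') k ->
  (0 < N)%N -> (N ^ 2 <= 2 ^ j * k)%N ->
  (logstar (N%:R : R) <= 961 * (j + 4) + 14)%N.
Proof.
move=> /perm_identity_triples[M [Mk M12 M23 M31 Mc]] N0 hk.
have V0 : (0 < #|{: 'I_N + 'I_N + 'I_N}|)%N by rewrite !card_sum card_ord !addn_gt0 N0.
have [|i hi hN] := @few_edges R _ (triangle_graph M) (@triangle_graph_sym N M)
  (@triangle_graph_ex N M) (@triangle_graph_uniq N M M12 M23 M31 Mc) (j + 4) _ V0.
  have := card_triangle_graph M12; rewrite Mk !card_sum card_ord => hE.
  (* The graph has 3N vertices, and (3N)^2 <= 16 N^2 turns [j] into [j + 4]. *)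
  apply: (@leq_trans (2 ^ j * 16 * k)); first by move: hk; rewrite !expnS expn0; lia.
  by rewrite expnD leq_mul2l hE orbT.
rewrite logstar_le ler_nat; apply: leq_trans (ltnW (leq_trans hN (tower_iter hi))).
by rewrite !card_sum card_ord; lia.
Qed.

Theorem mainTheorem9 (R : realType) :
  exists2 c : R, 0 < c &
    exists N0 : nat, forall (F : fieldType) (N : nat), (N0 <= N)%N ->
      (Qzo (matmul_tensor F N))%:R
        <= N%:R ^+ 2 / 2 `^ (c * (logstar (N%:R : R))%:R) :> R.
Proof.
(* As 1922 = 2 * 961, taking j = L %/ 1922 + 1 in [perm_identity_bound] gives L <= L / 2 + O(1),
   which bounds L. *)
exists (1922%:R^-1); first by rewrite invr_gt0 ltr0n.
have [H hH] : exists H, forall L, (L <= 961 * ((L %/ 1922).+1 + 4) + 14 -> L <= H)%N.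
  by exists (961 * 11)%N => L; lia.
exists (tower H).+1 => F N hN; set L := logstar _.
have N0 : (0 < N)%N by case: N hN {L}.
have HL : (H < L)%N by rewrite ltnNge logstar_le ler_nat -ltnNge.
have p0 : 0 < 2 `^ (1922%:R^-1 * L%:R) :> R by rewrite powR_gt0.
rewrite /Qzo; set bnd := _ / _.
apply: (big_ind (fun k : nat => k%:R <= bnd)); rewrite /bnd.
- by apply: divr_ge0; [exact: exprn_ge0 | exact: ltW].
- by move=> a b ha hb; rewrite /maxn; case: ifP.
move=> k /existsP[A' /existsP[B' /existsP[C' hk]]].
rewrite leNgt; apply/negP; rewrite ltr_pdivrMr // => lt.
suff : (L <= H)%N by rewrite leqNgt HL.
apply: hH; rewrite /L; apply: (@perm_identity_bound R F N k (L %/ 1922).+1 _ _ _ hk N0).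
(* A size [k] above the bound satisfies N^2 < 2^(L / 1922) k, and rounding the exponent up gives the
   natural number required. *)
rewrite -(ler_nat R) natrX natrM natrX; apply: le_trans (ltW lt) _.
rewrite mulrC ler_wpM2r // -powR_mulrn //; apply: ler_powR; first by rewrite ler1n.
rewrite ler_pdivrMl ?ltr0n // -natrM ler_nat.
by rewrite mulnC ltnW // ltn_ceil.
Qed.
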